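(* The partially ordered set $\mathrm{Subst}_L^{+}/{\approx}$ is isomorphic (as a partial order, hence as a lattice) to the lattice $\mathcal E_L/{\approx}$ of $\mathcal{E}$-formulas modulo $\approx$. In particular, $\mathrm{Subst}_L^{+}/{\approx}$ is a complete lattice with the class of the empty substitution as greatest element and the class of $\mathit{fail}$ as smallest element.
   Context: $L$ is a first-order language with equality whose function symbols include at least one constant. $\mathrm{FEA}(L)$ (free equality axioms): $f(\bar x)=f(\bar y)\leftrightarrow x_1=y_1\wedge\dots\wedge x_n=y_n$ for each $n$-ary $f$; $f(\bar x)=g(\bar y)\leftrightarrow\mathit{False}$ for distinct function symbols $f,g$; $x=t\leftrightarrow\mathit{False}$ whenever $x\not\equiv t$ and $x$ occurs in $t$. An $\mathcal{E}$-formula is a formula built from $\mathit{True}$, $\mathit{False}$ and equations using only $\wedge$ and $\exists$; $E\preceq E'$ iff $\mathrm{FEA}(L)\models E\to E'$, $E\approx E'$ iff $\mathrm{FEA}(L)\models E\leftrightarrow E'$; $\mathcal E_L/{\approx}$ is the quotient, ordered by $[E]\le[E']$ iff $E\preceq E'$. A (finite) substitution $\sigma$ is a map from a finite set $\mathrm{Dom}(\sigma)$ of variables to terms of $L$, written $\{x_1/s_1,\dots,x_n/s_n\}$; $\mathrm{Range}(\sigma)$ is the set of variables occurring in $s_1,\dots,s_n$. For a term $t$ with all variables in $\mathrm{Dom}(\sigma)$, $t\sigma$ is the result of simultaneously replacing each $x_i$ by $s_i$. If $\mathrm{Range}(\sigma)\subseteq\mathrm{Dom}(\tau)$, the composition $\sigma\tau$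 is the substitution over $\mathrm{Dom}(\sigma)$ with $(\sigma\tau)(x)=\sigma(x)\tau$. $\theta$ is an extension of $\sigma$ if $\mathrm{Dom}(\sigma)\subseteq\mathrm{Dom}(\theta)$ and $\theta$ agrees with $\sigma$ on $\mathrm{Dom}(\sigma)$. $\theta$ is a regular extension of $\sigma$ if it is an extension of $\sigma$ and it maps $\mathrm{Dom}(\theta)\setminus\mathrm{Dom}(\sigma)$ injectively into the set of variables not in $\mathrm{Range}(\sigma)$. $\sigma\preceq\theta$ iff there is a substitution $\tau$ with $\sigma'=\theta'\tau$ for some regular extensions $\sigma'$ of $\sigma$ and $\theta'$ of $\theta$ having the same domain; $\sigma\approx\theta$ iff $\sigma\preceq\theta$ and $\theta\preceq\sigma$. $\mathrm{Subst}_L$ is the set of all finite substitutions; $\mathrm{Subst}_L^{+}=\mathrm{Subst}_L\cup\{\mathit{fail}\}$ where $\mathit{fail}$ is a new object, and $\preceq$ is extended by declaring $\mathit{fail}\preceq\rho$ for every $\rho\in\mathrm{Subst}^{+}_L$ (and $\rho\preceq\mathit{fail}$ only for $\rho=\mathit{fail}$). $\mathrm{Subst}_L^{+}/{\approx}$ is the quotient, ordered by the induced partial order. *)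

(* Defs.v *)
From HB Require Import structures.
From mathcomp Require Import all_boot all_order finmap.
From mathcomp Require Import boolp classical_sets.

Set Implicit Arguments.
Unset Strict Implicit.
Unset Printing Implicit Defensive.

Import Order.Theory.

Local Open Scope fset_scope.
Local Open Scope fmap_scope.

Section PreorderQuotient.
Variables (T : choiceType) (r : T -> T -> Prop).
Hypothesis r_refl : forall x, r x x.
Hypothesis r_trans : forall x y z, r x y -> r y z -> r x z.

Definition preorder_eqv : rel T := fun x y => `[< r x y /\ r y x >].

Lemma preorder_eqv_refl : reflexive preorder_eqv.
Proof. by move=> x; apply/asboolP. Qed.

Lemma preorder_eqv_sym : symmetric preorder_eqv.
Proof. by move=> x y; apply/asboolP/asboolP => -[]. Qed.

Lemma preorder_eqv_trans : transitive preorder_eqv.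
Proof.
move=> y x z /asboolP[xy yx] /asboolP[yz zy]; apply/asboolP.
by split; [apply: r_trans xy yz | apply: r_trans zy yx].
Qed.

Definition preorder_equiv : equiv_rel T :=
  EquivRel preorder_eqv preorder_eqv_refl preorder_eqv_sym preorder_eqv_trans.

Definition preorder_quot := {eq_quot preorder_equiv}%qT.

HB.instance Definition _ := Choice.on preorder_quot.
HB.instance Definition _ := EqQuotient.on preorder_quot.

Definition preorder_quot_le : rel preorder_quot :=
  fun a b => `[< r (repr a) (repr b) >].

Lemma preorder_repr (x : T) :
  r (repr (\pi_preorder_quot x)%qT) x /\ r x (repr (\pi_preorder_quot x)%qT).
Proof.
have /eqmodP/asboolP// : (repr (\pi_preorder_quot x) = x %[mod preorder_quot])%qT.
by rewrite reprK.
Qed.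

Lemma preorder_quot_le_refl : reflexive preorder_quot_le.
Proof. by move=> a; apply/asboolP. Qed.

Lemma preorder_quot_le_anti : antisymmetric preorder_quot_le.
Proof.
move=> a b /andP[/asboolP ab /asboolP ba]; rewrite -[a]reprK -[b]reprK.
by apply/eqmodP/asboolP.
Qed.

Lemma preorder_quot_le_trans : transitive preorder_quot_le.
Proof.
by move=> b a c /asboolP ab /asboolP bc; apply/asboolP; apply: r_trans ab bc.
Qed.

HB.instance Definition _ :=
  Order.Le_isPOrder.Build (Order.Disp tt tt) preorder_quot
    preorder_quot_le_refl preorder_quot_le_anti preorder_quot_le_trans.

Lemma le_piE (x y : T) :
  (\pi_preorder_quot x <= \pi_preorder_quot y)%O%qT = `[< r x y >].
Proof.
have [xr rx] := preorder_repr x; have [yr ry] := preorder_repr y.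
apply/asboolP/asboolP => xy.
  by apply: r_trans rx (r_trans xy yr).
by apply: r_trans xr (r_trans xy ry).
Qed.
End PreorderQuotient.

Record language := Language {
  funsym : Type;
  farity : funsym -> nat;
  relsym : Type;
  rarity : relsym -> nat }.

Notation var := nat (only parsing).

Section Syntax.
Variable L : language.

Inductive term :=
| Var of var
| App (f : funsym L) of ('I_(farity f) -> term).

Fixpoint tvars (t : term) : {fset var} :=
  match t with
  | Var x => [fset x]
  | App f ts => (\bigcup_(i <- enum 'I_(farity f)) tvars (ts i))%fset
  end.

Inductive formula :=
| FTrue
| FFalse
| FEq of term & term
| FRel (p : relsym L) of ('I_(rarity p) -> term)
| FAnd of formula & formula
| FOr of formula & formula
| FImp of formula & formula
| FIff of formula & formula
| FEx of var & formula
| FAll of var & formula.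

(* There is no negation constructor: the negation of [p] is [FImp p FFalse]. *)

HB.instance Definition _ := gen_eqMixin term.
HB.instance Definition _ := gen_choiceMixin term.
HB.instance Definition _ := gen_eqMixin formula.
HB.instance Definition _ := gen_choiceMixin formula.
End Syntax.

Arguments Var {L} x.
Arguments App {L} f ts.
Arguments FTrue {L}.
Arguments FFalse {L}.

Record structure (L : language) := Structure {
  dom : Type;
  dom_inhabited : inhabited dom;
  finterp : forall f : funsym L, ('I_(farity f) -> dom) -> dom;
  rinterp : forall p : relsym L, ('I_(rarity p) -> dom) -> Prop }.

Section Semantics.
Variables (L : language) (M : structure L).
Implicit Types v : var -> dom M.

Fixpoint teval v (t : term L) : dom M :=
  match t with
  | Var x => v x
  | App f ts => finterp (fun i => teval v (ts i))
  end.

Definition upd v (x : var) (a : dom M) : var -> dom M :=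
  fun y => if y == x then a else v y.

Fixpoint sat v (p : formula L) : Prop :=
  match p with
  | FTrue => True
  | FFalse => False
  | FEq s t => teval v s = teval v t
  | FRel p ts => rinterp (fun i => teval v (ts i))
  | FAnd p q => sat v p /\ sat v q
  | FOr p q => sat v p \/ sat v q
  | FImp p q => sat v p -> sat v q
  | FIff p q => sat v p <-> sat v q
  | FEx x p => exists a, sat (upd v x a) p
  | FAll x p => forall a, sat (upd v x a) p
  end.

(* Formulas with free variables are read as their universal closures. *)
Definition valid (p : formula L) : Prop := forall v, sat v p.
End Semantics.

Definition entails (L : language) (A : set (formula L)) (p : formula L) : Prop :=
  forall M : structure L, (forall q, A q -> valid M q) -> valid M p.

(* [x] and [y] range over all families of variables, including those with
   repetitions; such instances follow from those with distinct variables. *)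
Inductive FEA (L : language) : set (formula L) :=
| FEA_inj (f : funsym L) (x y : 'I_(farity f) -> var) :
    FEA (FIff (FEq (App f (fun i => Var (x i))) (App f (fun i => Var (y i))))
              (\big[@FAnd L/FTrue]_(i < farity f) FEq (Var (x i)) (Var (y i))))
| FEA_clash (f g : funsym L)
      (x : 'I_(farity f) -> var) (y : 'I_(farity g) -> var) :
    f <> g ->
    FEA (FIff (FEq (App f (fun i => Var (x i))) (App g (fun i => Var (y i))))
              FFalse)
| FEA_occurs (x : var) (t : term L) :
    t <> Var x -> x \in tvars t -> FEA (FIff (FEq (Var x) t) FFalse).

Fixpoint is_eformula (L : language) (p : formula L) : bool :=
  match p with
  | FTrue | FFalse | FEq _ _ => true
  | FAnd p q => is_eformula p && is_eformula q
  | FEx _ p => is_eformula p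
  | _ => false
  end.

Record eformula (L : language) := EFormula {
  eformula_val :> formula L;
  _ : is_eformula eformula_val }.

Section EFormulas.
Variable L : language.

HB.instance Definition _ := [isSub for @eformula_val L].
HB.instance Definition _ := [Choice of eformula L by <:].

Definition eformula_le (E E' : eformula L) : Prop :=
  entails (@FEA L) (FImp E E').

Lemma eformula_le_refl E : eformula_le E E.
Proof. by move=> M _ v. Qed.

Lemma eformula_le_trans E1 E2 E3 :
  eformula_le E1 E2 -> eformula_le E2 E3 -> eformula_le E1 E3.
Proof. by move=> h12 h23 M ax v /(h12 M ax v) /(h23 M ax v). Qed.
End EFormulas.

Notation subst L := {fmap var -> term L}.

Section Substitutions.
Variable L : language.
Implicit Types (s t th : subst L).

Definition srange s : {fset var} := (\bigcup_(u <- codomf s) tvars u)%fset.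

(* The default [Var x] is a totalization: application of [s] to a term is only
   meaningful when all the variables of the term are in [domf s]. *)
Fixpoint tsubst s (u : term L) : term L :=
  match u with
  | Var x => odflt (Var x) s.[? x]
  | App f us => App f (fun i => tsubst s (us i))
  end.

(* Meaningful when [srange s `<=` domf t], a condition imposed in [subst_le]. *)
Definition scomp s t : subst L := [fmap x : domf s => tsubst t (s x)].

Definition extension s th : Prop :=
  domf s `<=` domf th /\ {in domf s, forall x, th.[? x] = s.[? x]}.

Definition regular_extension s th : Prop :=
  [/\ extension s th,
      {in domf th `\` domf s, forall x,
         exists2 y, th.[? x] = Some (Var y) & y \notin srange s} &
      {in domf th `\` domf s &, injective (fun x => th.[? x])}].

Definition subst_le s th : Prop :=
  exists s' th' t : subst L,
    [/\ regular_extension s s', regular_extension th th',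
        domf s' = domf th', srange th' `<=` domf t & s' = scomp th' t].

Lemma srangeP s y :
  reflect (exists x u, s.[? x] = Some u /\ y \in tvars u) (y \in srange s).
Proof.
apply: (iffP idP) => [/bigfcupP[u /andP[/codomfP[x sx] _] yu]|[x [u [sx yu]]]].
  by exists x, u.
by apply/bigfcupP; exists u => //; rewrite andbT; apply/codomfP; exists x.
Qed.

Lemma fnd_scomp s t x : (scomp s t).[? x] = omap (tsubst t) s.[? x].
Proof.
have [xs|xs] := boolP (x \in domf s); last by rewrite !not_fnd.
have xc : x \in scomp s t by [].
rewrite (in_fnd xc) (in_fnd xs) /= ffunE; congr (Some (tsubst t (s _))).
exact: val_inj.
Qed.

Lemma eq_tsubst s t u :
  {in tvars u, forall x, s.[? x] = t.[? x]} -> tsubst s u = tsubst t u.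
Proof.
elim: u => [x|f us IH] st /=; first by rewrite st // in_fset1.
congr App; apply: funext => i; apply: IH => x xu; apply: st => /=.
by apply/bigfcupP; exists i; rewrite ?mem_enum.
Qed.

Lemma tsubst_scomp s t u :
  tvars u `<=` domf s -> tsubst (scomp s t) u = tsubst t (tsubst s u).
Proof.
elim: u => [x|f us IH] /= us_s.
  have xs : x \in domf s by apply: (fsubsetP us_s); rewrite in_fset1.
  by rewrite fnd_scomp (in_fnd xs).
congr App; apply: funext => i; apply: IH; apply: fsubset_trans us_s.
by apply: bigfcup_sup; rewrite ?mem_enum.
Qed.

Lemma tvars_tsubst s u y :
  y \in tvars (tsubst s u) -> exists2 x, x \in tvars u & y \in tvars (tsubst s (Var x)).
Proof.
elim: u => [x|f us IH] /=; first by exists x; rewrite ?in_fset1.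
move=> /bigfcupP[i _ /IH[x xu yx]]; exists x => //.
by apply/bigfcupP; exists i; rewrite ?mem_enum.
Qed.

Lemma regular_extension_exists s (D : {fset var}) :
  domf s `<=` D -> exists2 s', regular_extension s s' & domf s' = D.
Proof.
move=> sD; pose N := \max_(y <- srange s) y.+1.
have N_gt y : y \in srange s -> (y < N)%N.
  by move=> ys; apply: (@leq_bigmax_seq _ _ xpredT (fun y => y.+1)).
exists [fmap x : D => odflt (Var (N + val x)) s.[? val x]] => //.
set s' := FinMap _.
have s'E x : x \in D -> s'.[? x] = Some (odflt (Var (N + x)) s.[? x]).
  by move=> xD; rewrite (@in_fnd _ _ s' x xD) /s' /= ffunE.
have new x : x \in domf s' `\` domf s -> s'.[? x] = Some (Var (N + x)).
  by rewrite in_fsetD => /andP[xs xD]; rewrite s'E // not_fnd.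
split.
- split=> // x xs; rewrite s'E; last exact: (fsubsetP sD).
  by rewrite (in_fnd xs).
- move=> x /new ->; exists (N + x)%N => //.
  by apply: contraTN isT => /N_gt; rewrite ltnNge leq_addr.
- by move=> x y /new sx /new sy; rewrite /= sx sy => -[] /addnI.
Qed.

(* The domain and the regular extensions in [subst_le] may be chosen at will. *)
Lemma subst_leP s th s' th' :
  subst_le s th -> regular_extension s s' -> regular_extension th th' ->
  domf s' = domf th' ->
  exists t : subst L, srange th' `<=` domf t /\ s' = scomp th' t.
Proof.
move=> [s1 [th1 [t [[[ss1 s1E] s1new s1inj] [[thth1 th1E] th1new _]]]]].
move=> eqD1 th1t def_s1 [[ss' s'E] _ _] [[thth' th'E] th'new th'inj] eqD.
pose ren : subst L := [fmap v : srange s1 =>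
  match [pick x : domf th | (val x \notin domf s) &&
                            (s1.[? val x] == Some (Var (val v)))] with
  | Some x => odflt (Var 0) s'.[? val x]
  | None => Var (val v)
  end].
pose t' : subst L := [fmap y : srange th' =>
  match [pick x : domf th' | (val x \notin domf th) &&
                            (th'.[? val x] == Some (Var (val y)))] with
  | Some x => odflt (Var 0) s'.[? val x]
  | None => tsubst ren (tsubst t (Var (val y)))
  end].
have tvars_s1 x u : s1.[? x] = Some u -> tvars u `<=` srange s1.
  by move=> sx; apply/fsubsetP => y yu; apply/srangeP; exists x, u.
have tvars_th1 x u : th1.[? x] = Some u -> tvars u `<=` srange th1.
  by move=> sx; apply/fsubsetP => y yu; apply/srangeP; exists x, u.
have tsubst_id (r : subst L) u :
    {in tvars u, forall y, r.[? y] = Some (Var y)} -> tsubst r u = u.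
  elim: u => [x|f us IH] /= h; first by rewrite h ?in_fset1.
  congr App; apply: funext => i; apply: IH => y yi; apply: h.
  by apply/bigfcupP; exists i; rewrite ?mem_enum.
have ren_id x u : x \in domf s -> s1.[? x] = Some u -> tsubst ren u = u.
  move=> xs s1x; apply: tsubst_id => y yu.
  have ys1 : y \in srange s1 by apply/srangeP; exists x, u.
  rewrite (@in_fnd _ _ ren y ys1) /ren /= ffunE /=; case: pickP => //= z /andP[zs /eqP s1z].
  have zD : val z \in domf s1 `\` domf s.
    by rewrite in_fsetD zs -fndSome s1z.
  have [w] := s1new _ zD; rewrite s1z => -[<-] /srangeP[].
  by exists x, u; rewrite -s1E.
have ren_new x u : x \in domf th -> x \notin domf s -> s1.[? x] = Some u ->
    Some (tsubst ren u) = s'.[? x].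
  move=> xth xs s1x.
  have xs1 : x \in domf s1 by rewrite -fndSome s1x.
  have xD : x \in domf s1 `\` domf s by rewrite in_fsetD xs.
  have [w] := s1new _ xD; rewrite s1x => -[def_u] _; subst u.
  have ws1 : w \in srange s1 by apply/srangeP; exists x, (Var w); rewrite s1x in_fset1.
  rewrite /= (@in_fnd _ _ ren w ws1) /ren /= ffunE /=.
  case: pickP => /= [z /andP[zs /eqP s1z]|/(_ [` xth])]; last first.
    by rewrite /= xs s1x eqxx.
  have zD : val z \in domf s1 `\` domf s.
    by rewrite in_fsetD zs -fndSome s1z.
  have -> : val z = x by apply: s1inj => //=; rewrite s1x s1z.
  have xs' : x \in domf s' by rewrite eqD; apply: (fsubsetP thth').
  by rewrite (in_fnd xs').
exists t'; split; first exact: fsubset_refl.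
apply/fmapP => x; rewrite fnd_scomp.
have [xD|xD] := boolP (x \in domf th'); last first.
  have xs' : x \notin domf s' by rewrite eqD.
  by rewrite (not_fnd xs') (not_fnd xD).
have xD' : x \in domf s' by rewrite eqD.
have [xth|xth] := boolP (x \in domf th); last first.
  have xN : x \in domf th' `\` domf th by rewrite in_fsetD xth.
  have [w th'x _] := th'new _ xN; rewrite th'x /=.
  have wr : w \in srange th' by apply/srangeP; exists x, (Var w); rewrite in_fset1.
  rewrite (@in_fnd _ _ t' w wr) /t' /= ffunE /=.
  case: pickP => /= [z /andP[zth /eqP th'z]|/(_ [` xD])]; last first.
    by rewrite /= xth th'x eqxx.
  have zN : val z \in domf th' `\` domf th.
    by rewrite in_fsetD zth -fndSome th'z.
  have -> : val z = x by apply: th'inj => //=; rewrite th'x th'z.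
  by rewrite (in_fnd xD').
have [u def_u] : exists u, th.[? x] = Some u by exists th.[xth]; rewrite in_fnd.
have th1x : th1.[? x] = Some u by rewrite th1E.
rewrite th'E // def_u /=.
have -> : tsubst t' u = tsubst ren (tsubst t u).
  rewrite -tsubst_scomp; last exact: fsubset_trans (tvars_th1 _ _ th1x) th1t.
  apply: eq_tsubst => y yu.
  have yr : y \in srange th' by apply/srangeP; exists x, u; rewrite th'E.
  have yt : y \in domf t.
    by apply: (fsubsetP th1t); apply: (fsubsetP (tvars_th1 _ _ th1x)).
  rewrite fnd_scomp (in_fnd yt) (@in_fnd _ _ t' y yr) /t' /= ffunE /=.
  case: pickP => /= [z /andP[zth /eqP th'z]|_]; last by rewrite (in_fnd yt).
  have zN : val z \in domf th' `\` domf th.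
    by rewrite in_fsetD zth -fndSome th'z.
  have [w] := th'new _ zN; rewrite th'z => -[<-] /srangeP[].
  by exists x, u.
have s1x : s1.[? x] = Some (tsubst t u) by rewrite def_s1 fnd_scomp th1x.
have [xs|xs] := boolP (x \in domf s); last first.
  by rewrite (ren_new x _ xth xs s1x).
by rewrite (ren_id x) // s'E // -s1E.
Qed.

Lemma subst_le_refl s : subst_le s s.
Proof.
have reg : regular_extension s s.
  by split; [split| |] => // x; rewrite fsetDv in_fset0.
pose t : subst L := [fmap y : srange s => Var (val y)].
exists s, s, t; split=> //.
have tid u : tvars u `<=` srange s -> tsubst t u = u.
  elim: u => [y|f us IH] /= us_s.
    have ys : y \in srange s by apply: (fsubsetP us_s); rewrite in_fset1.
    by rewrite (@in_fnd _ _ t y ys) /t /= ffunE.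
  congr App; apply: funext => i; apply: IH; apply: fsubset_trans us_s.
  by apply: bigfcup_sup; rewrite ?mem_enum.
apply/fmapP => x; rewrite fnd_scomp; case def_u: s.[? x] => [u|] //=.
by rewrite tid //; apply/fsubsetP => y yu; apply/srangeP; exists x, u.
Qed.

Lemma subst_le_trans s1 s2 s3 : subst_le s1 s2 -> subst_le s2 s3 -> subst_le s1 s3.
Proof.
move=> le12 le23; pose D := domf s1 `|` domf s2 `|` domf s3.
have [|s1' r1 d1] := @regular_extension_exists s1 D.
  by rewrite /D -fsetUA fsubsetUl.
have [|s2' r2 d2] := @regular_extension_exists s2 D.
  by rewrite /D fsetUAC fsubsetUr.
have [|s3' r3 d3] := @regular_extension_exists s3 D; first exact: fsubsetUr.
have [|t [s2t def_s1]] := subst_leP le12 r1 r2; first by rewrite d1.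
have [|t' [s3t' def_s2]] := subst_leP le23 r2 r3; first by rewrite d2.
exists s1', s3', (scomp t' t); split=> //; first by rewrite d1.
apply/fmapP => x; rewrite def_s1 def_s2 !fnd_scomp.
case def_u: s3'.[? x] => [u|] //=; rewrite tsubst_scomp //.
by apply: fsubset_trans s3t'; apply/fsubsetP => y yu; apply/srangeP; exists x, u.
Qed.
End Substitutions.

Inductive substp (L : language) := Subst of subst L | Fail.
Arguments Fail {L}.

Section SubstPlus.
Variable L : language.

HB.instance Definition _ := gen_eqMixin (substp L).
HB.instance Definition _ := gen_choiceMixin (substp L).

Definition substp_le (a b : substp L) : Prop :=
  match a, b with
  | Fail, _ => True
  | Subst _, Fail => False
  | Subst s, Subst th => subst_le s th
  end.

Lemma substp_le_refl a : substp_le a a.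
Proof. by case: a => //= s; apply: subst_le_refl. Qed.

Lemma substp_le_trans a b c : substp_le a b -> substp_le b c -> substp_le a c.
Proof. by case: a b c => [s|] [t|] [u|] //=; apply: subst_le_trans. Qed.
End SubstPlus.

Definition eformula_quot (L : language) :=
  preorder_quot (@eformula_le_refl L) (@eformula_le_trans L).

Definition substp_quot (L : language) :=
  preorder_quot (@substp_le_refl L) (@substp_le_trans L).

HB.instance Definition _ (L : language) := Order.POrder.on (eformula_quot L).
HB.instance Definition _ (L : language) := EqQuotient.on (eformula_quot L).
HB.instance Definition _ (L : language) := Order.POrder.on (substp_quot L).
HB.instance Definition _ (L : language) := EqQuotient.on (substp_quot L).

Section OrderPredicates.
Context {d : Order.disp_t} (T : porderType d).
Implicit Types (x y z : T) (A : set T).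

Definition is_join x y z : Prop := supremums [set x; y]%classic z.
Definition is_meet x y z : Prop := infimums [set x; y]%classic z.

Definition is_lattice : Prop :=
  forall x y, (exists z, is_join x y z) /\ (exists z, is_meet x y z).

Definition is_complete_lattice : Prop :=
  forall A, (exists z, supremums A z) /\ (exists z, infimums A z).
End OrderPredicates.

(* Main.v *)
(* A substitution [s] stands for the set of valuations that are instances of it, that
   is, of the form [x |-> eval w (s x)] on its domain. In all models of the free equality
   axioms the solutions of a finite set of equations are either none or the instances of
   its most general unifier; hence each E-formula defines the set of instances of some
   substitution (or the empty set, for [Fail]), and conversely. Evaluating in the term
   algebra, itself a model of the axioms, shows that [subst_le] is inclusion of these
   sets, which gives the isomorphism.
   Binary meets exist by unification. Above a given substitution [s] it suffices to
   consider substitutions with the domain of [s], and there descending chains are finite: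
   going down, the number of function symbols grows and is bounded by that of [s], and
   when it is constant the number of variables decreases. So the upper bounds of any
   subset have a least element. *)
Require Import Defs.
From HB Require Import structures.
From mathcomp Require Import all_boot all_order finmap.
From mathcomp Require Import boolp classical_sets.
From Stdlib Require Import Eqdep_dec.

Set Implicit Arguments.
Unset Strict Implicit.
Unset Printing Implicit Defensive.

Import Order.Theory.

(** * Terms and the term algebra *)

Section FreeEquality.
Local Open Scope fset_scope.
Local Open Scope fmap_scope.
Variable L : language.
Implicit Types (s t u : term L) (M : structure L) (x y z : nat).

Lemma tvars_AppP f (ts : 'I_(farity f) -> term L) x :
  reflect (exists i, x \in tvars (ts i)) (x \in tvars (App f ts)).
Proof.
apply: (iffP idP) => [/bigfcupP[i _ xi]|[i xi]]; first by exists i.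
by apply/bigfcupP; exists i; rewrite ?mem_enum.
Qed.

Lemma sub_tvars_App f (ts : 'I_(farity f) -> term L) i :
  tvars (ts i) `<=` tvars (App f ts).
Proof. by apply/fsubsetP => x xi; apply/tvars_AppP; exists i. Qed.

Lemma eq_teval M (v w : nat -> dom M) t :
  {in tvars t, v =1 w} -> teval v t = teval w t.
Proof.
elim: t => [x|f ts IH] vw /=; first by rewrite vw ?in_fset1.
congr finterp; apply: funext => i; apply: IH => x xi; apply: vw.
by apply/tvars_AppP; exists i.
Qed.

Lemma App_inj f (ss ts : 'I_(farity f) -> term L) : App f ss = App f ts -> ss = ts.
Proof.
(* Injectivity of [App] only gives an equality of dependent pairs; classical decidability of
   equality on function symbols turns it into one of arguments. *)
case=> eq_args; apply: (inj_pair2_eq_dec _ _ _ _ _ _ eq_args) => f1 f2.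
exact: pselect.
Qed.

(** Terms with variables form the domain, so a valuation is a total substitution and evaluation
    ([inst]) is its application. *)
Definition term_structure : structure L :=
  @Structure L (term L) (inhabits (Var 0)) (@App L) (fun _ _ => True).

Definition inst (w : nat -> term L) t : term L := teval (M := term_structure) w t.

Lemma inst_Var t : inst Var t = t.
Proof.
elim: t => [//|f ts IH]; rewrite /inst /=; congr App.
by apply: funext => i; apply: IH.
Qed.

Lemma eq_inst (v w : nat -> term L) t : {in tvars t, v =1 w} -> inst v t = inst w t.
Proof. exact: (@eq_teval term_structure). Qed.

Lemma teval_inst M (v : nat -> dom M) w t :
  teval v (inst w t) = teval (fun x => teval v (w x)) t.
Proof.
elim: t => [//|f ts IH]; rewrite /inst /=; congr finterp.
by apply: funext => i; apply: IH.
Qed.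

Lemma inst_comp v w t : inst v (inst w t) = inst (fun x => inst v (w x)) t.
Proof. exact: (@teval_inst term_structure). Qed.

Lemma inst_App w f (ts : 'I_(farity f) -> term L) :
  inst w (App f ts) = App f (fun i => inst w (ts i)).
Proof. by []. Qed.

Lemma tvars_instP w t y :
  reflect (exists2 x, x \in tvars t & y \in tvars (w x)) (y \in tvars (inst w t)).
Proof.
apply: (iffP idP) => [|[x]].
  elim: t => [x|f ts IH]; first by exists x; rewrite ?in_fset1.
  rewrite inst_App => /tvars_AppP[i /IH[x xi yx]]; exists x => //.
  by apply/tvars_AppP; exists i.
elim: t => [x'|f ts IH]; first by rewrite in_fset1 => /eqP->.
move=> /tvars_AppP[i xi] yx; rewrite inst_App; apply/tvars_AppP; exists i.
exact: IH.
Qed.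

Lemma tsubst_inst (s : subst L) w t :
  {in tvars t, forall x, s.[? x] = Some (w x)} -> tsubst s t = inst w t.
Proof.
elim: t => [x|f ts IH] sw; first by rewrite /= sw ?in_fset1.
rewrite inst_App /=; congr App; apply: funext => i; apply: IH => x xi; apply: sw.
by apply/tvars_AppP; exists i.
Qed.

Fixpoint nsym t : nat :=
  match t with
  | Var _ => 0
  | App f ts => (\sum_(i < farity f) nsym (ts i)).+1
  end.

Lemma nsym_inst_ge w t : nsym t <= nsym (inst w t).
Proof.
elim: t => [//|f ts IH]; rewrite inst_App /= ltnS.
by apply: leq_sum => i _; apply: IH.
Qed.

Lemma nsym_inst_in w t x : x \in tvars t -> nsym (w x) + nsym t <= nsym (inst w t).
Proof.
elim: t => [y|f ts IH]; first by rewrite in_fset1 addn0 => /eqP->.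
move=> /tvars_AppP[i xi]; rewrite inst_App /= addnS ltnS (bigD1 i) //=.
rewrite [leqRHS](bigD1 i) //= addnA leq_add ?IH //.
by apply: leq_sum => j _; apply: nsym_inst_ge.
Qed.

Lemma nsym0_Var t : nsym t = 0 -> exists x, t = Var x.
Proof. by case: t => [x _|//]; exists x. Qed.

(** * Models of the free equality axioms *)

Definition fea_model M : Prop := forall p, @FEA L p -> valid M p.

Lemma sat_big_FAnd M (I : eqType) (r : seq I) (F : I -> formula L) (v : nat -> dom M) :
  sat v (\big[@FAnd L/FTrue]_(i <- r) F i) <-> {in r, forall i, sat v (F i)}.
Proof.
elim: r => [|i r IH]; first by rewrite big_nil.
rewrite big_cons /= IH; split=> [[vi vr] j|h].
  by rewrite in_cons => /predU1P[->//|]; apply: vr.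
by split=> [|j jr]; apply: h; rewrite in_cons ?eqxx // jr orbT.
Qed.

Lemma fea_inj M f (a b : 'I_(farity f) -> dom M) :
  fea_model M -> finterp a = finterp b -> a = b.
Proof.
case: (dom_inhabited M) => d0 feaM ab.
(* The axioms speak of variables only, so the elements of [a] are stored at even variables and those
   of [b] at odd ones; [d0] fills the rest. *)
pose v n := if insub (n./2) is Some i then (if odd n then b i else a i) else d0.
have va i : v (val i).*2 = a i by rewrite /v odd_double doubleK valK.
have vb i : v (val i).*2.+1 = b i by rewrite /v /= odd_double /= uphalf_double valK.
have := feaM _ (FEA_inj (fun i : 'I_(farity f) => (val i).*2)
                        (fun i : 'I_(farity f) => (val i).*2.+1)) v.
rewrite /= sat_big_FAnd => -[+ _].
have -> : (fun i : 'I_(farity f) => v (val i).*2) = a by apply: funext.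
have -> : (fun i : 'I_(farity f) => v (val i).*2.+1) = b by apply: funext.
move=> /(_ ab) h; apply: funext => i; rewrite -va -vb.
by apply: h; rewrite mem_index_enum.
Qed.

Lemma fea_clash M f g (a : 'I_(farity f) -> dom M) (b : 'I_(farity g) -> dom M) :
  fea_model M -> f <> g -> finterp a <> finterp b.
Proof.
case: (dom_inhabited M) => d0 feaM fg ab.
pose v n := if odd n then (if insub (n./2) is Some i then b i else d0)
            else (if insub (n./2) is Some i then a i else d0).
have va i : v (val i).*2 = a i by rewrite /v odd_double doubleK valK.
have vb i : v (val i).*2.+1 = b i by rewrite /v /= odd_double /= uphalf_double valK.
have := feaM _ (FEA_clash (fun i : 'I_(farity f) => (val i).*2)
                          (fun i : 'I_(farity g) => (val i).*2.+1) fg) v.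
move=> /= [+ _]; apply.
have -> : (fun i : 'I_(farity f) => v (val i).*2) = a by apply: funext.
by have -> : (fun i : 'I_(farity g) => v (val i).*2.+1) = b by apply: funext.
Qed.

Lemma fea_occurs M (v : nat -> dom M) x t :
  fea_model M -> t <> Var x -> x \in tvars t -> v x <> teval v t.
Proof. by move=> feaM tx xt; have [+ _] := feaM _ (FEA_occurs tx xt) v. Qed.

Lemma fea_term_structure : fea_model term_structure.
Proof.
move=> p [f x y|f g x y fg|x t tx xt] v; rewrite /= ?sat_big_FAnd.
- split=> [/App_inj xy i _|xy]; first exact: (congr1 (fun h => h i) xy).
  by congr App; apply: funext => i; apply: xy; rewrite mem_index_enum.
- by split=> // -[].
(* A value of [x] equal to that of a term properly containing [x] would have more function symbols
   than itself. *)
- split=> // vx; have := nsym_inst_in v xt; rewrite [inst _ _](esym vx).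
  case: t tx xt {vx} => [y tx|f ts _ _]; last by rewrite /= addnS ltnNge leq_addr.
  by rewrite in_fset1 => /eqP xy; case: tx; rewrite xy.
Qed.

(** * Unification in all models of the axioms *)

Definition semprop := forall M, (nat -> dom M) -> Prop.

(* [mu] is a most general unifier of [S], characterized through its instances. *)
Definition principal (S : semprop) : Prop :=
  (forall M, fea_model M -> forall v, ~ S M v) \/
  exists mu : nat -> term L, forall M, fea_model M -> forall v,
    S M v <-> exists w, forall z, v z = teval w (mu z).

Lemma eq_principal (S S' : semprop) :
  (forall M, fea_model M -> forall v, S M v <-> S' M v) ->
  principal S -> principal S'.
Proof.
move=> SS' [no|[mu muP]]; [left=> M fM v /(SS' M fM)|right].
  exact: no.
by exists mu => M fM v; rewrite -SS' // muP.
Qed.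

Definition eqs_hold (E : seq (term L * term L)) : semprop :=
  fun M v => {in E, forall e, teval v e.1 = teval v e.2}.

Lemma eqs_hold_cons e E M (v : nat -> dom M) :
  eqs_hold (e :: E) v <-> teval v e.1 = teval v e.2 /\ eqs_hold E v.
Proof.
split=> [h|[he hE] e'].
  by split=> [|e' e'E]; apply: h; rewrite in_cons ?eqxx // e'E orbT.
by rewrite in_cons => /predU1P[->//|]; apply: hE.
Qed.

Definition elim_var x t := inst (upd (M := term_structure) Var x t).

Lemma teval_elim_var M (v : nat -> dom M) x t u :
  v x = teval v t -> teval v (elim_var x t u) = teval v u.
Proof.
move=> vx; rewrite /elim_var teval_inst; apply: eq_teval => y _.
by rewrite /upd; case: eqP => // ->.
Qed.

Lemma tvars_elim_var x t u (V : {fset nat}) :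
  x \notin tvars t -> tvars t `<=` V -> tvars u `<=` V ->
  tvars (elim_var x t u) `<=` V `\ x.
Proof.
move=> xt /fsubsetP tV /fsubsetP uV; apply/fsubsetP => y /tvars_instP[z zu].
rewrite /upd in_fsetD1; case: eqP => [_ yt|zx].
  by rewrite tV // andbT; apply: contraNneq xt => <-.
by rewrite in_fset1 => /eqP->; rewrite uV // andbT; apply/eqP.
Qed.

(** A most general unifier of the remaining equations, in which [x] no longer occurs, is corrected
    at [x] to send it to the instance of [t]. *)
Lemma principal_elim_var x t E : x \notin tvars t ->
  principal (eqs_hold [seq (elim_var x t e.1, elim_var x t e.2) | e <- E]) ->
  principal (eqs_hold ((Var x, t) :: E)).
Proof.
move=> xt; set E' := [seq _ | e <- E].
have elimE M (v : nat -> dom M) : v x = teval v t -> eqs_hold E' v <-> eqs_hold E v.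
  move=> vx; split=> h e.
    move=> eE; have := h _ (map_f _ eE).
    by rewrite /= !teval_elim_var.
  by move=> /mapP[e' e'E ->]; rewrite /= !teval_elim_var //; apply: h.
case=> [no|[mu muP]]; [left|right].
  by move=> M fM v /eqs_hold_cons[/= vx hE]; apply: (no M fM v); apply/elimE.
exists (fun z => if z == x then inst mu t else mu z) => M fM v.
rewrite eqs_hold_cons /=; split=> [[vx]|[w wP]].
  move=> /(elimE _ _ vx) /(muP M fM)[w wP]; exists w => z; case: eqP => // ->.
  by rewrite vx teval_inst; apply: eq_teval => y _; apply: wP.
have vx : v x = teval v t.
  rewrite wP eqxx teval_inst; apply: eq_teval => y yt; rewrite wP.
  by case: eqP => // yx; rewrite -yx yt in xt.
split=> //; apply/(elimE _ _ vx).
have hE' : eqs_hold E' (fun z => teval w (mu z)) by apply/(muP M fM); exists w.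
have tE u : x \notin tvars u -> teval v u = teval (fun z => teval w (mu z)) u.
  move=> xu; apply: eq_teval => z zu; rewrite wP.
  by case: eqP => // zx; rewrite -zx zu in xu.
have x_elim u : x \notin tvars (elim_var x t u).
  have /fsubsetP h : tvars (elim_var x t u) `<=` (tvars t `|` tvars u) `\ x.
    by apply: tvars_elim_var; rewrite ?fsubsetUl ?fsubsetUr.
  by apply/negP => /h; rewrite in_fsetD1 eqxx.
by move=> e eE'; have := hE' e eE'; move: eE' => /mapP[e' _ ->]; rewrite /= !tE.
Qed.

(** Termination of unification: lexicographic induction on the size of a set [V] containing the
    variables, the number of function symbols, and the list of equations. *)
Lemma principal_eqs (E : seq (term L * term L)) : principal (eqs_hold E).
Proof.
pose inV (V : {fset nat}) (E : seq (term L * term L)) :=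
  {in E, forall e, tvars e.1 `<=` V /\ tvars e.2 `<=` V}.
have [V EV] : exists V, inV V E.
  exists (\bigcup_(e <- E) (tvars e.1 `|` tvars e.2)) => e eE.
  by split; apply: fsubset_trans (bigfcup_sup _ eE isT);
    rewrite ?fsubsetUl ?fsubsetUr.
have [n] := ubnP #|` V|; elim: n V E EV => // n IHn V E EV ltVn.
have [k] := ubnP (\sum_(e <- E) (nsym e.1 + nsym e.2)).
elim: k E EV => // k IHk; elim=> [_ _|[s t] E IHE EV].
  right; exists Var => M fM v; split=> [_|_ e]; last by rewrite in_nil.
  by exists v.
rewrite big_cons /= ltnS => le_k.
have [sV tV] : tvars s `<=` V /\ tvars t `<=` V.
  by apply: (EV (s, t)); rewrite in_cons eqxx.
have EV' : inV V E by move=> e eE; apply: EV; rewrite in_cons eE orbT.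
(* A trivial equation is dropped by the induction on the list, the occurs check refutes the system,
   and elimination removes [x] from [V], after which the number of symbols may grow. *)
have VarE x u : x \in V -> tvars u `<=` V ->
    \sum_(e <- E) (nsym e.1 + nsym e.2) <= k ->
    principal (eqs_hold ((Var x, u) :: E)).
  move=> xV uV le_kE; have [->|/eqP ux] := eqVneq u (Var x).
    apply: eq_principal (IHE EV' _); last by rewrite ltnS.
    by move=> M fM v; rewrite eqs_hold_cons; split=> [|[]].
  have [xu|xu] := boolP (x \in tvars u).
    by left=> M fM v /eqs_hold_cons[/(fea_occurs fM ux xu)].
  apply: principal_elim_var => //; apply: (IHn (V `\ x)).
    move=> e /mapP[e' /EV'[e1 e2] ->].
    by split; apply: tvars_elim_var.
  by move: ltVn; rewrite (cardfsD1 x) xV.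
case: s t le_k sV tV EV => [x|f ss] [y|g ts] le_k sV tV EV.
- by apply: VarE => //; rewrite -fsub1set.
- apply: VarE => //; first by rewrite -fsub1set.
  exact: leq_trans (leq_addl _ _) le_k.
- apply: (@eq_principal (eqs_hold ((Var y, App f ss) :: E))).
    by move=> M fM v; rewrite !eqs_hold_cons; split=> -[].
  apply: VarE => //; first by rewrite -fsub1set.
  exact: leq_trans (leq_addl _ _) le_k.
have [fg|fg] := pselect (f = g); last first.
  by left=> M fM v /eqs_hold_cons[/(fea_clash fM fg)].
subst g.
(* Decomposition into arguments removes the two head symbols. *)
pose E' := [seq (ss i, ts i) | i <- enum 'I_(farity f)] ++ E.
apply: (@eq_principal (eqs_hold E')).
  move=> M fM v; rewrite eqs_hold_cons /=; split=> [h|[/(fea_inj fM) h hE] e].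
    split=> [|e eE]; last by apply: h; rewrite mem_cat eE orbT.
    congr finterp; apply: funext => i; apply: (h (ss i, ts i)).
    by rewrite mem_cat map_f ?mem_enum.
  rewrite mem_cat => /orP[/mapP[i _ ->]|]; last exact: hE.
  exact: (congr1 (fun h => h i) h).
apply: IHk.
  move=> e; rewrite mem_cat => /orP[/mapP[i _ ->]|]; last exact: EV'.
  by split; [apply: fsubset_trans sV|apply: fsubset_trans tV]; apply: sub_tvars_App.
rewrite big_cat big_map big_enum /= big_split /=.
by apply: leq_trans le_k; rewrite ltn_add2r addSn ltnS leq_add2l.
Qed.
End FreeEquality.

(** * Sets of instances over a finite domain *)

Section Instances.
Local Open Scope fset_scope.
Local Open Scope fmap_scope.
Variable L : language.
Implicit Types (t u : term L) (M : structure L) (x y z : nat) (D : {fset nat}).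
Implicit Types (g h : nat -> term L) (s : subst L) (a b : substp L).

Definition instances D g : semprop L :=
  fun M v => exists w, {in D, forall x, v x = teval w (g x)}.

Lemma eq_instances D g h M (v : nat -> dom M) :
  {in D, g =1 h} -> instances D g v <-> instances D h v.
Proof.
by move=> gh; split=> -[w wP]; exists w => x xD; rewrite wP ?gh.
Qed.

(** In the term algebra [g] is an instance of itself, hence of [h]. *)
Lemma instances_le D g h :
  (forall v, instances D g v -> instances D h (M := term_structure L) v) ->
  exists w, {in D, forall x, g x = inst w (h x)}.
Proof. by move/(_ g); apply; exists (@Var L) => x _; rewrite [RHS]inst_Var. Qed.

Lemma instances_inst D g h w M (v : nat -> dom M) :
  {in D, forall x, g x = inst w (h x)} -> instances D g v -> instances D h v.
Proof.
move=> gh [w' w'P]; exists (fun y => teval w' (w y)) => x xD.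
by rewrite w'P // gh // teval_inst.
Qed.

(** Projection of a solution set: [r x] is the unknown standing for [x], and the other unknowns are
    quantified away by forgetting their terms. *)
Lemma instances_principal (S : semprop L) D (r : nat -> nat) : principal S ->
  (forall M, fea_model M -> forall v : nat -> dom M, ~ S M v) \/
  exists g, forall M, fea_model M -> forall v : nat -> dom M, instances D g v <->
    exists2 u, S M u & {in D, forall x, v x = u (r x)}.
Proof.
case=> [no|[mu muP]]; [by left|right].
exists (fun x => mu (r x)) => M fM v; split=> [[w wP]|[u /(muP M fM)[w wP] vu]].
  by exists (fun z => teval w (mu z)) => //; apply/muP => //; exists w.
by exists w => x xD; rewrite vu.
Qed.

(* The variables of [g1] and [g2] are renamed apart: [D] is embedded in the even
   numbers, the variables of [g1] are moved to [4 y + 1], those of [g2] to [4 y + 3]. *)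
Lemma instances_meet D1 g1 D2 g2 :
  (forall M, fea_model M -> forall v : nat -> dom M,
     ~ (instances D1 g1 v /\ instances D2 g2 v)) \/
  exists g, forall M, fea_model M -> forall v : nat -> dom M,
    instances (D1 `|` D2) g v <-> instances D1 g1 v /\ instances D2 g2 v.
Proof.
pose r1 y := y.*2.*2.+1; pose r2 y := y.*2.+1.*2.+1.
pose E r D g := [seq (@Var L x.*2, inst (fun y => Var (r y)) (g x)) | x <- D].
have EP r D g M (u : nat -> dom M) : eqs_hold (E r D g) u <->
    {in D, forall x, u x.*2 = teval (fun y => u (r y)) (g x)}.
  split=> [h x xD|h e /mapP[x xD ->]]; last by rewrite /= teval_inst; apply: h.
  have := h (Var x.*2, inst (fun y => Var (r y)) (g x)).
  by rewrite /= teval_inst; apply; apply: map_f.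
have catE M (u : nat -> dom M) : eqs_hold (E r1 D1 g1 ++ E r2 D2 g2) u <->
    eqs_hold (E r1 D1 g1) u /\ eqs_hold (E r2 D2 g2) u.
  split=> [h|[h1 h2] e]; last by rewrite mem_cat => /orP[]; [apply: h1|apply: h2].
  by split=> e eE; apply: h; rewrite mem_cat eE ?orbT.
have split_sol M (v : nat -> dom M) : instances D1 g1 v /\ instances D2 g2 v <->
    exists2 u, eqs_hold (E r1 D1 g1 ++ E r2 D2 g2) u &
      {in D1 `|` D2, forall x, v x = u x.*2}.
  split=> [[[w1 w1P] [w2 w2P]]|[u /catE[/EP u1 /EP u2] vu]]; last first.
    split; [exists (fun y => u (r1 y))|exists (fun y => u (r2 y))] => x xD.
      by rewrite -u1 // vu // in_fsetU xD.
    by rewrite -u2 // vu // in_fsetU xD orbT.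
  pose u n := if odd n then (if odd n./2 then w2 n./2./2 else w1 n./2./2) else v n./2.
  have uv x : u x.*2 = v x by rewrite /u odd_double doubleK.
  have u1 y : u (r1 y) = w1 y.
    by rewrite /u /r1 /= odd_double /= uphalf_double odd_double doubleK.
  have u2 y : u (r2 y) = w2 y.
    by rewrite /u /r2 /= odd_double /= uphalf_double /= odd_double /= uphalf_double.
  exists u => //; apply/catE; split; apply/EP => x xD; rewrite uv.
    by rewrite w1P //; apply: eq_teval => y _; rewrite u1.
  by rewrite w2P //; apply: eq_teval => y _; rewrite u2.
have [no|[g gP]] := instances_principal (D1 `|` D2) double
    (principal_eqs (E r1 D1 g1 ++ E r2 D2 g2)); [left|right].
  by move=> M fM v /split_sol[u uE _]; apply: (no M fM u).
by exists g => M fM v; rewrite gP // split_sol.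
Qed.

Lemma instances_extend D D' g : D `<=` D' ->
  exists g', forall M (v : nat -> dom M), instances D' g' v <-> instances D g v.
Proof.
move=> /fsubsetP DD'.
(* With the variables of [g] moved to even numbers, each added point gets its own odd variable and
   so an arbitrary value. *)
exists (fun x => if x \in D then inst (fun y => Var y.*2) (g x) else Var x.*2.+1).
move=> M v; split=> -[w wP].
  exists (fun y => w y.*2) => x xD.
  by rewrite wP ?DD' // xD teval_inst.
exists (fun n => if odd n then v n./2 else w n./2) => x xD'.
case: ifP => xD; last by rewrite /= odd_double /= uphalf_double.
rewrite wP // teval_inst; apply: eq_teval => y _.
by rewrite /= odd_double doubleK.
Qed.

(* If [h] is more general than [g], the variables outside of the domain of [g] are
   mapped by [h] to variables which do not occur elsewhere in [h]. *)
Lemma instances_restrict D g D' h : D `<=` D' ->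
  (forall v, instances D g v -> instances D' h (M := term_structure L) v) ->
  forall M (v : nat -> dom M), instances D h v <-> instances D' h v.
Proof.
move=> /fsubsetP DD' gh.
(* A generic instance of [g]: odd variables mark the points outside [D] and do not occur in the
   values on [D]. *)
pose v0 x := if x \in D then inst (fun y => Var y.*2) (g x) else Var x.*2.+1.
have [w wP] : instances D' h (M := term_structure L) v0.
  apply: gh; exists (fun y => @Var L y.*2) => x xD.
  by rewrite /v0 xD.
move=> M v; split=> -[w1 w1P]; last by exists w1 => x /DD'; apply: w1P.
(* If [w z] is the odd variable marking [x], then [z] is free to take the value [v x]; such a [z]
   does not occur in [h] on [D]. *)
exists (fun z => if w z is Var n then (if odd n then v n./2 else w1 z) else w1 z).
move=> x xD'; have := wP x xD'; rewrite /v0; case: ifP => xD.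
  rewrite w1P // => gx; apply: eq_teval => y yx.
  case wy: (w y) => [n|//]; case: ifP => // n_odd.
  have /tvars_instP[z _] : n \in tvars (inst (fun y => @Var L y.*2) (g x)).
    rewrite gx; apply/tvars_instP; exists y => //.
    by rewrite wy in_fset1.
  by rewrite in_fset1 => /eqP nz; rewrite nz odd_double in n_odd.
case: (h x) => [z /= <-|//].
by rewrite /= odd_double /= uphalf_double.
Qed.

(** * The order on substitutions as inclusion of instances *)

Definition sfun s x := odflt (Var x) s.[? x].

Definition denot a : semprop L :=
  fun M v => if a is Subst s then instances (domf s) (sfun s) v else False.

Definition frestr D g : subst L := [fmap x : D => g (val x)].

Lemma fnd_frestr D g x : x \in D -> (frestr D g).[? x] = Some (g x).
Proof. by move=> xD; rewrite (@in_fnd _ _ (frestr D g) x xD) /= ffunE. Qed.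

Lemma denot_frestr D g M (v : nat -> dom M) :
  denot (Subst (frestr D g)) v <-> instances D g v.
Proof. by apply: eq_instances => x xD; rewrite /sfun fnd_frestr. Qed.

Lemma denot_nonempty s : exists v, denot (Subst s) (M := term_structure L) v.
Proof. by exists (sfun s), (@Var L) => x _; rewrite [RHS]inst_Var. Qed.

(** Added points go to distinct variables outside the range of [s], so their values are
    unconstrained. *)
Lemma regular_extension_instances s s' M (v : nat -> dom M) :
  regular_extension s s' ->
  instances (domf s') (sfun s') v <-> instances (domf s) (sfun s) v.
Proof.
move=> [[/fsubsetP ss' s'E] new inj]; split=> -[w wP].
  exists w => x xs; have -> : sfun s x = sfun s' x by rewrite /sfun s'E.
  exact/wP/ss'.
pose new_at y x := x \in domf s' `\` domf s /\ s'.[? x] = Some (Var y).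
(* [w] is changed only at images of added points; by [inj] the point chosen for such a [y] is the
   only one. *)
exists (fun y => if pselect (exists x, new_at y x) is left ex
                 then v (projT1 (cid ex)) else w y) => x xs'.
have [xs|xs] := boolP (x \in domf s); last first.
  have xN : x \in domf s' `\` domf s by rewrite in_fsetD xs.
  have [y s'x _] := new x xN; rewrite /sfun s'x /=.
  case: pselect => [ex|[]]; last by exists x.
  case: (cid ex) => x' [x'N s'x'] /=; congr v; apply: inj => //=.
  by rewrite s'x s'x'.
have -> : sfun s' x = sfun s x by rewrite /sfun s'E.
rewrite wP //; apply: eq_teval => y yx; case: pselect => // ex.
case: (cid ex) => x' [x'N s'x'] /=; have [z] := new x' x'N.
rewrite s'x' => -[<-] /srangeP[]; exists x, s.[xs].
by rewrite (in_fnd xs); split=> //; move: yx; rewrite /sfun (in_fnd xs).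
Qed.

Lemma denot_subst_le s th M (v : nat -> dom M) :
  subst_le s th -> denot (Subst s) v -> denot (Subst th) v.
Proof.
move=> [s' [th' [t [rs rth eqD _ def_s']]]] /(regular_extension_instances _ rs) sv.
apply/(regular_extension_instances _ rth); rewrite -eqD.
apply: (instances_inst (w := sfun t)) sv => x xs'.
have tE u : tsubst t u = inst (sfun t) u.
  elim: u => [//|f us IH]; rewrite inst_App /=; congr App.
  by apply: funext => i; apply: IH.
have s'x : s'.[? x] = omap (tsubst t) th'.[? x] by rewrite [in LHS]def_s' fnd_scomp.
rewrite eqD in xs'.
by rewrite /sfun s'x -tE (in_fnd xs').
Qed.

(** Over a common domain, inclusion makes the extension of [s] an instance of that of [th]; the
    instantiation, cut down to the range, is the required factor. *)
Lemma subst_le_denot s th :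
  (forall v, denot (Subst s) v -> denot (Subst th) (M := term_structure L) v) ->
  subst_le s th.
Proof.
move=> le; pose D := domf s `|` domf th.
have [|s' rs ds] := @regular_extension_exists L s D; first exact: fsubsetUl.
have [|th' rth dth] := @regular_extension_exists L th D; first exact: fsubsetUr.
have [|w wP] := @instances_le D (sfun s') (sfun th').
  move=> v; rewrite -{1}ds -dth => /(regular_extension_instances _ rs)/le.
  by move=> /(regular_extension_instances _ rth).
exists s', th', (frestr (srange th') w); split; rewrite ?ds ?dth //.
apply/fmapP => x; rewrite fnd_scomp.
have [xD|xD] := boolP (x \in D); last first.
  have xs : x \notin domf s' by rewrite ds.
  have xth : x \notin domf th' by rewrite dth.
  by rewrite (not_fnd xs) (not_fnd xth).
have := wP x xD.
have xs : x \in domf s' by rewrite ds.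
have xth : x \in domf th' by rewrite dth.
rewrite /sfun (in_fnd xs) (in_fnd xth) /= => ->; congr Some; symmetry.
apply: tsubst_inst => y yx; apply: fnd_frestr; apply/srangeP.
by exists x, th'.[xth]; rewrite in_fnd.
Qed.

Definition sem_le (S S' : semprop L) : Prop :=
  forall M, fea_model M -> forall v : nat -> dom M, S M v -> S' M v.

Definition sem_eq (S S' : semprop L) : Prop :=
  forall M, fea_model M -> forall v : nat -> dom M, S M v <-> S' M v.

(** The converse direction evaluates in the term algebra only, where moreover no substitution has an
    empty set of instances, which separates it from [Fail]. *)
Lemma substp_leP a b : substp_le a b <-> sem_le (denot a) (denot b).
Proof.
case: a b => [s|] [th|]; split=> //=.
- by move=> le M _ v; apply: denot_subst_le.
- by move=> le; apply: subst_le_denot => v; apply/le/fea_term_structure.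
- have [v sv] := denot_nonempty s.
  by move=> /(_ _ (@fea_term_structure L) v sv).
- by move=> _ M _ v.
- by move=> _ M _ v.
Qed.

(** * Correspondence between substitutions and E-formulas *)

Lemma denot_meet a b : exists c, sem_eq (denot c) (fun M v => denot a v /\ denot b v).
Proof.
case: a b => [s|] [th|]; try by exists Fail => M fM v /=; split=> // -[].
have [no|[g gP]] := instances_meet (domf s) (sfun s) (domf th) (sfun th).
  by exists Fail => M fM v /=; split=> // /no; apply.
exists (Subst (frestr (domf s `|` domf th) g)) => M fM v.
by rewrite denot_frestr gP.
Qed.

(** Equations are solved by unification, conjunctions are meets, and an existential quantifier
    removes its variable from the domain. *)
Lemma denot_of_eformula (p : formula L) :
  is_eformula p -> exists a, sem_eq (denot a) (fun M v => sat v p).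
Proof.
elim: p => //= [_|_|t u _|p IHp q IHq /andP[/IHp[a aP] /IHq[b bP]]|x p IHp /IHp[a aP]].
- exists (Subst [fmap]) => M fM v; split=> // _.
  by exists v => x; rewrite in_fset0.
- by exists Fail.
- have [no|[g gP]] := instances_principal (tvars t `|` tvars u) id
      (principal_eqs [:: (t, u)]).
    exists Fail => M fM v; split=> //= tu; apply: (no M fM v) => e.
    by rewrite in_cons in_nil orbF => /eqP->.
  exists (Subst (frestr (tvars t `|` tvars u) g)) => M fM v.
  rewrite denot_frestr gP //; split=> [[w eqw vw]|tu].
    have := eqw (t, u); rewrite in_cons eqxx => /(_ isT) /=.
    by rewrite (@eq_teval _ M v w t) ?(@eq_teval _ M v w u) // => y yt;
      rewrite vw // in_fsetU yt ?orbT.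
  by exists v => // e; rewrite in_cons in_nil orbF => /eqP->.
- have [c cP] := denot_meet a b; exists c => M fM v.
  by rewrite cP // aP // bP.
case: a aP => [s|] aP; last first.
  by exists Fail => M fM v; split=> //= -[d /(aP M fM)].
exists (Subst (frestr (domf s `\ x) (sfun s))) => M fM v.
rewrite denot_frestr; split=> [[w wP]|[d /(aP M fM)[w wP]]].
  exists (teval w (sfun s x)); apply/aP => //; exists w => y ys.
  rewrite /upd; case: eqP => [->//|/eqP yx].
  by apply: wP; rewrite in_fsetD1 yx.
exists w => y; rewrite in_fsetD1 => /andP[/negPf yx ys].
by rewrite -wP // /upd yx.
Qed.

Definition fexists (r : seq nat) (p : formula L) : formula L := foldr (@FEx L) p r.

Lemma sat_fexists r p M (v : nat -> dom M) :
  sat v (fexists r p) <-> exists2 u, sat u p & forall x, x \notin r -> v x = u x.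
Proof.
elim: r v => [|y r IH] v /=.
  split=> [pv|[u pu vu]]; first by exists v.
  by have -> : v = u by apply: funext => x; apply: vu.
split=> [[d /IH[u pu vu]]|[u pu vu]].
  exists u => // x; rewrite in_cons negb_or => /andP[/negPf xy xr].
  by rewrite -vu // /upd xy.
exists (u y); apply/IH; exists u => // x xr; rewrite /upd; case: eqP => [->//|/eqP xy].
by apply: vu; rewrite in_cons negb_or xy.
Qed.

Lemma is_eformula_fexists r p : is_eformula (fexists r p) = is_eformula p.
Proof. by elim: r. Qed.

Lemma is_eformula_big (I : Type) (r : seq I) (F : I -> formula L) :
  (forall i, is_eformula (F i)) -> is_eformula (\big[@FAnd L/FTrue]_(i <- r) F i).
Proof.
move=> hF; elim: r => [|i r IH]; first by rewrite big_nil.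
by rewrite big_cons /= hF.
Qed.

(** The formula equates each [x] of the domain with its term, whose variables are quantified
    existentially after a shift by [N] beyond the domain. *)
Lemma eformula_of_denot a : exists E : eformula L,
  forall M (v : nat -> dom M), sat v E <-> denot a v.
Proof.
case: a => [s|]; last by exists (@EFormula L FFalse isT).
pose N := \max_(x <- domf s) x.+1.
have N_gt x : x \in domf s -> x < N.
  by move=> xs; apply: (@leq_bigmax_seq _ _ xpredT succn).
pose V := \bigcup_(x <- domf s) tvars (sfun s x).
pose ren := inst (fun y => @Var L (N + y)).
pose p := fexists (map (addn N) V)
  (\big[@FAnd L/FTrue]_(x <- domf s) FEq (Var x) (ren (sfun s x))).
have p_e : is_eformula p by rewrite is_eformula_fexists is_eformula_big.
exists (EFormula p_e) => M v /=; rewrite sat_fexists; split.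
  move=> [u /sat_big_FAnd us vu]; exists (fun y => u (N + y)%N) => x xs.
  rewrite vu; first by have := us x xs; rewrite /= teval_inst.
  by apply/mapP => -[y _ xy]; have := N_gt x xs; rewrite xy ltnNge leq_addr.
move=> [w wP]; exists (fun x => if x \in map (addn N) V then w (x - N)%N else v x);
  last by move=> x /negPf->.
apply/sat_big_FAnd => x xs /=; rewrite teval_inst.
case: ifPn => [/mapP[y _ xy]|_]; first by have := N_gt x xs; rewrite xy ltnNge leq_addr.
rewrite wP //; apply: eq_teval => y yx /=; rewrite map_f ?addKn //.
by apply/bigfcupP; exists x; rewrite ?xs.
Qed.

(** * Size, number of variables and least upper bounds *)

Lemma nsym_sum_le D g h :
  sem_le (instances D g) (instances D h) ->
  \sum_(x <- D) nsym (h x) <= \sum_(x <- D) nsym (g x).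
Proof.
move=> /(_ _ (@fea_term_structure L)) /instances_le[w wP].
rewrite !big_seq; apply: leq_sum => x xD.
by rewrite wP // nsym_inst_ge.
Qed.

Definition varset D g : {fset nat} := \bigcup_(x <- D) tvars (g x).

Lemma varsetP D g y :
  reflect (exists2 x, x \in D & y \in tvars (g x)) (y \in varset D g).
Proof.
apply: (iffP (bigfcupP _ _ _ _)) => [[x /andP[xD _] yx]|[x xD yx]]; exists x => //.
by rewrite xD.
Qed.

(* Equality of the total sizes forces the instantiation to be a renaming of variables,
   and then the number of variables can only decrease, strictly if the renaming
   identifies two of them. *)
Lemma instances_rigid D g h :
  sem_le (instances D g) (instances D h) ->
  \sum_(x <- D) nsym (g x) = \sum_(x <- D) nsym (h x) ->
  #|` varset D g| <= #|` varset D h| /\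
  (#|` varset D g| = #|` varset D h| -> sem_le (instances D h) (instances D g)).
Proof.
move=> /(_ _ (@fea_term_structure L)) /instances_le[w wP] eq_size.
(* A function symbol in [w y] would make the total size of [g] strictly larger than that of [h]. *)
have wVar y : y \in varset D h -> exists z, w y = Var z.
  move=> /varsetP[x xD yx]; apply: nsym0_Var; apply/eqP.
  have : \sum_(x <- D) nsym (g x) <= \sum_(x <- D) nsym (h x) by rewrite eq_size.
  rewrite 2?(big_fsetD1 x xD) /=; apply: contraLR; rewrite -lt0n -ltnNge => wy.
  rewrite -addSn leq_add //.
    by rewrite wP //; apply: leq_trans (nsym_inst_in w yx); rewrite -add1n leq_add2r.
  rewrite !big_seq; apply: leq_sum => z; rewrite in_fsetD1 => /andP[_ zD].
  by rewrite wP // nsym_inst_ge.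
pose r y := if w y is Var z then z else 0.
have wr y : y \in varset D h -> w y = Var (r y).
  by move=> /wVar[z wy]; rewrite /r wy.
pose R := map r (varset D h).
have gR : varset D g =i R.
  move=> z; apply/varsetP/mapP => [[x xD]|[y yh ->]].
    rewrite wP // => /tvars_instP[y yx].
    have yh : y \in varset D h by apply/varsetP; exists x.
    by rewrite wr // in_fset1 => /eqP->; exists y.
  have /varsetP[x xD yx] := yh; exists x => //.
  by rewrite wP //; apply/tvars_instP; exists y; rewrite // wr ?in_fset1.
have uD f : uniq (varset D f) by apply: fset_uniq.
split.
  by rewrite -(size_map r (varset D h)); apply: uniq_leq_size => // z; rewrite gR.
move=> eq_card M _ v.
(* Equal cardinalities make [r] injective on the variables of [h]; positions in [R] then provide its
   inverse. *)
have uR : uniq R by rewrite (uniq_size_uniq (uD g) gR) size_map -eq_card.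
apply: (@instances_inst _ _ _ (fun z => Var (nth 0 (varset D h) (index z R)))) => x xD.
rewrite wP // inst_comp -[LHS]inst_Var; apply: eq_inst => y yx.
have yh : y \in varset D h by apply/varsetP; exists x.
have iy : index y (varset D h) < size (varset D h) by rewrite index_mem.
rewrite wr // /inst /=; congr Var.
have -> : r y = nth 0 R (index y (varset D h)) by rewrite (nth_map 0) // nth_index.
by rewrite index_uniq ?size_map // nth_index.
Qed.
End Instances.

(* Going down from upper bounds of [A], the total size of the terms increases, but it is
   bounded by the size of any substitution of [A]; among the upper bounds of maximal size,
   one with the fewest variables is the least, since it is equivalent to its meets with
   all other upper bounds. *)
Lemma substp_sup (L : language) (A : set (substp L)) :
  exists c, (forall a, A a -> substp_le a c) /\
    forall b, (forall a, A a -> substp_le a b) -> substp_le c b.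
Proof.
(* If [A] contains no proper substitution, its least upper bound is [Fail]. *)
have [[s As]|nA] := pselect (exists s, A (Subst s)); last first.
  exists Fail; split=> // -[s As|//]; by case: nA; exists s.
pose D := domf s.
pose Q g := forall a, A a -> sem_le (denot a) (instances D g).
pose total (g : nat -> term L) := \sum_(x <- D) nsym (g x).
pose P1 k := `[< exists2 g, Q g & total g = k >].
(* Every valuation is an instance of [Var], which is therefore an upper bound. *)
have exP1 : exists k, P1 k.
  exists (total (@Var L)); apply/asboolP; exists (@Var L) => // a _ M _ v _.
  by exists v.
have bP1 k : P1 k -> k <= total (sfun s).
  by move=> /asboolP[g /(_ _ As) le <-]; apply: nsym_sum_le.
case: (ex_maxnP exP1 bP1) => k /asboolP[g1 Qg1 g1k] k_max.
pose P2 n := `[< exists g, [/\ Q g, total g = k & #|` varset D g| = n] >].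
have exP2 : exists n, P2 n.
  by exists #|` varset D g1|; apply/asboolP; exists g1.
case: (ex_minnP exP2) => n /asboolP[g0 [Qg0 g0k g0n]] n_min {g1 Qg1 g1k exP1 bP1 exP2}.
exists (Subst (frestr D g0)); split=> [a Aa|b ub].
  by apply/substp_leP => M fM v av; apply/denot_frestr/(Qg0 a).
case: b ub => [th|] ub; last by have := ub _ As.
(* The upper bound [th] is brought to the domain [D] by extending it to the union of both domains,
   then restricting; the latter is sound because [s] lies below. *)
have [g' g'E] := instances_extend (sfun th) (fsubsetUr D (domf th)).
have g'D : forall M (v : nat -> dom M), instances D g' v <-> denot (Subst th) v.
  move=> M v; rewrite -[denot _ _]/(instances _ _ v) -g'E.
  apply: (@instances_restrict _ D (sfun s)); first exact: fsubsetUl.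
  move=> u su; apply/g'E.
  by have /substp_leP := ub _ As; apply=> //; apply: fea_term_structure.
(* The meet is not empty, since it contains the instances of [s]. *)
have [no|[h hP]] := instances_meet D g0 D g'.
  have [v sv] := denot_nonempty s; case: (no _ (@fea_term_structure L) v).
  split; first exact: (Qg0 _ As _ (@fea_term_structure L)).
  by apply/g'D; have /substp_leP := ub _ As; apply=> //; apply: fea_term_structure.
rewrite fsetUid in hP.
have Qh : Q h.
  move=> a Aa M fM v av; apply/hP => //; split; first exact: (Qg0 a).
  by apply/g'D; have /substp_leP := ub _ Aa; apply.
have h_g0 : sem_le (instances D h) (instances D g0) by move=> M fM v /(hP _ fM)[].
have hk : total h = k.
  apply/eqP; rewrite eqn_leq -{2}g0k nsym_sum_le // andbT.
  by apply: k_max; apply/asboolP; exists h.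
have [le_card rigid] := instances_rigid h_g0 (etrans hk (esym g0k)).
apply/substp_leP => M fM v /denot_frestr g0v; apply/g'D.
apply: proj2 (_ : instances D g0 v /\ _); apply/hP => //; apply: rigid => //.
apply/eqP; rewrite eqn_leq le_card g0n n_min //.
by apply/asboolP; exists h.
Qed.

(** * Transport along order isomorphisms; completeness *)

Section OrderIso.
Context {d d' : Order.disp_t} (T : porderType d) (T' : porderType d').
Variables (f : T -> T') (g : T' -> T).
Hypotheses (gK : cancel g f) (f_mono : {mono f : x y / (x <= y)%O}).

Lemma supremums_image (A : set T) z :
  supremums A z -> supremums (f @` A)%classic (f z).
Proof.
move=> [ubz lubz]; split=> [_ [x Ax <-]|y uby]; first by rewrite f_mono; apply: ubz.
rewrite -[y]gK f_mono; apply: lubz => x Ax.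
by rewrite -f_mono gK; apply: uby; exists x.
Qed.

Lemma infimums_image (A : set T) z :
  infimums A z -> infimums (f @` A)%classic (f z).
Proof.
move=> [lbz glbz]; split=> [_ [x Ax <-]|y lby]; first by rewrite f_mono; apply: lbz.
rewrite -[y]gK f_mono; apply: glbz => x Ax.
by rewrite -f_mono gK; apply: lby; exists x.
Qed.

Lemma is_join_image x y z : is_join x y z -> is_join (f x) (f y) (f z).
Proof. by move/supremums_image; rewrite image_setU !image_set1. Qed.

Lemma is_meet_image x y z : is_meet x y z -> is_meet (f x) (f y) (f z).
Proof. by move/infimums_image; rewrite image_setU !image_set1. Qed.

Lemma is_lattice_image : is_lattice T -> is_lattice T'.
Proof.
move=> lat x y; have [[j jP] [m mP]] := lat (g x) (g y).
by split; [exists (f j); have := is_join_image jP|exists (f m); have := is_meet_image mP];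
  rewrite !gK.
Qed.
End OrderIso.

(** The infimum of a set is the supremum of its lower bounds. *)
Lemma complete_of_sup d (T : porderType d) :
  (forall A : set T, exists z, supremums A z) -> is_complete_lattice T.
Proof.
move=> sup A; split=> //; have [z [zub zlub]] := sup (lbound A).
by exists z; split=> [x Ax|y ylb]; [apply: zlub => y; apply|apply: zub].
Qed.

Lemma complete_is_lattice d (T : porderType d) : is_complete_lattice T -> is_lattice T.
Proof. by move=> cT x y; apply: cT. Qed.

(** * The quotients and their isomorphism *)

Lemma substp_quot_leP (L : language) (a b : substp L) :
  (\pi_(substp_quot L) a <= \pi_(substp_quot L) b)%O%qT <-> substp_le a b.
Proof.
have -> := le_piE (@substp_le_refl L) (@substp_le_trans L) a b.
by split=> /asboolP.
Qed.

Lemma eformula_quot_leP (L : language) (E E' : eformula L) :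
  (\pi_(eformula_quot L) E <= \pi_(eformula_quot L) E')%O%qT <-> eformula_le E E'.
Proof.
have -> := le_piE (@eformula_le_refl L) (@eformula_le_trans L) E E'.
by split=> /asboolP.
Qed.

Lemma substp_quot_complete (L : language) : is_complete_lattice (substp_quot L).
Proof.
apply: complete_of_sup => A.
have [c [ubc lubc]] := substp_sup [set a | A (\pi_(substp_quot L) a)%qT].
exists (\pi_(substp_quot L) c)%qT; split=> [q|q ubq]; rewrite -[q]reprK.
  by move=> Aq; apply/substp_quot_leP/ubc.
apply/substp_quot_leP/lubc => a Aa.
by apply/substp_quot_leP; rewrite reprK; apply: ubq.
Qed.

(** The class of a substitution goes to that of a formula defining the same valuations; both orders
    are inclusion in the models of the axioms. *)
Lemma substp_eformula_iso (L : language) :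
  exists f : substp_quot L -> eformula_quot L,
    bijective f /\ {mono f : a b / (a <= b)%O}.
Proof.
pose F a := sval (cid (@eformula_of_denot L a)).
have FE a : forall M (v : nat -> dom M), sat v (F a) <-> denot a v.
  by rewrite /F; case: cid.
have F_le a b : eformula_le (F a) (F b) <-> substp_le a b.
  rewrite substp_leP; split=> le M fM v.
    by move=> /FE Fv; apply/FE/(le M fM).
  by move=> /FE av; apply/FE/(le M fM).
pose f (q : substp_quot L) := (\pi_(eformula_quot L) (F (repr q)))%qT.
have f_mono : {mono f : a b / (a <= b)%O}.
  move=> a b; rewrite -{2}[a]reprK -{2}[b]reprK.
  by apply/idP/idP => [/eformula_quot_leP/F_le/substp_quot_leP|
    /substp_quot_leP/F_le/eformula_quot_leP].
have f_surj (q : eformula_quot L) : exists p, f p = q.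
  have [a aE] := denot_of_eformula (valP (repr q)).
  exists (\pi_(substp_quot L) a)%qT; rewrite -[q]reprK /f.
  have [ra ar] := preorder_repr (@substp_le_refl L) (@substp_le_trans L) a.
  apply/eqP; rewrite eq_le; apply/andP; split; apply/eformula_quot_leP => M fM v.
    by move=> /FE av; apply/aE => //; have /substp_leP := ra; apply.
  by move=> /aE av; apply/FE; have /substp_leP := ar; apply=> //; apply: av.
(* The inverse chooses preimages; monotonicity in both directions and antisymmetry make [f]
   injective. *)
exists f; split=> //; exists (fun q => sval (cid (f_surj q))) => [p|q]; last first.
  by case: cid.
by case: cid => p' /= fp'; apply/eqP; rewrite eq_le -!f_mono fp' lexx.
Qed.

Theorem theorem5p14 (L : language)
    (L_const : exists c : funsym L, farity c = 0%N) :
  [/\ exists f : substp_quot L -> eformula_quot L,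
        [/\ bijective f,
            {mono f : a b / (a <= b)%O},
            forall a b c : substp_quot L, is_join a b c ->
              is_join (f a) (f b) (f c) &
            forall a b c : substp_quot L, is_meet a b c ->
              is_meet (f a) (f b) (f c)],
      is_lattice (eformula_quot L),
      is_complete_lattice (substp_quot L),
      (forall a : substp_quot L,
         (a <= \pi_(substp_quot L) (Subst [fmap]%fmap))%O%qT) &
      (forall a : substp_quot L,
         (\pi_(substp_quot L) (@Fail L) <= a)%O%qT)].
Proof.
have [f [[g fK gK] f_mono]] := substp_eformula_iso L.
have complete := @substp_quot_complete L.
split=> // [||a|a].
- exists f; split=> // [|a b c|a b c]; first by exists g.
    exact: is_join_image.
  exact: is_meet_image.
- exact: is_lattice_image gK f_mono (complete_is_lattice complete).
(* Over the empty domain every valuation is an instance. *)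
- rewrite -[a]reprK; apply/substp_quot_leP/substp_leP => M _ v _.
  by exists v => x; rewrite in_fset0.
- by rewrite -[a]reprK; apply/substp_quot_leP.
Qed.
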